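(* Let $A=(A,d,\cdot\,)$ be a differential graded associative algebra over a field $\Bbbk$, with cohomology $H=H(A,d)$, and let $x_1,\ldots,x_n\in H$, $n\ge 2$, be an ordered list of homogeneous cohomology classes. Let $(H,0,\mu_2,\mu_3,\ldots)$ be a canonical minimal model of $A$ with connecting $A_\infty$-morphism $\psi_\infty=(\psi,\psi_2,\psi_3,\ldots):(H,0,\mu_2,\mu_3,\ldots)\to(A,d,\cdot\,,0,0,\ldots)$. Suppose that each operation $\mu_k$ of this structure with $k\le n-1$ satisfies $$\mu_k(x_u,\ldots,x_v)=0$$ for every subinterval $x_u,\ldots,x_v$ of $x_1,\ldots,x_n$ of length $k$. Then the elements $$a_{u,u}:=\psi(x_u),\quad 1\le u\le n,$$ $$a_{u,v}:=(-1)^{\frac{(v-u)(v-u+1)}2+\sum_{i=0}^{v-u}(u+v+i)|x_{u+i}|}\,\psi_{v-u+1}(x_u,\ldots,x_v),\quad 1\le u<v\le n,$$ form a defining system for the $n$-fold Massey product $\langle x_1,\ldots,x_n\rangle$, and $$\varepsilon\cdot\mu_n(x_1,\ldots,x_n)\in\langle x_1,\ldots,x_n\rangle,\qquad\text{where}\quad \varepsilon:=(-1)^{\frac{(n+2)(n+1)}2+\sum_{i=1}^n(n+i)|x_i|}.$$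
   Context: All objects are over a field $\Bbbk$; complexes are cochain complexes (differentials of degree $+1$), possibly unbounded; $[a]$ denotes the cohomology class of a cocycle $a$; $\overline a:=(-1)^{|a|}a$. Koszul sign rule is used when evaluating tensor products of maps on elements. A subinterval of $x_1,\ldots,x_n$ of length $k\ge2$ is a sequence $x_u,\ldots,x_v$ of $k$ consecutive entries. Massey products. A defining system for $\langle x_1,\ldots,x_n\rangle$ is a scheme $D=\{a_{u,v}\in A\mid 1\le u\le v\le n\}$ of homogeneous elements with $|a_{u,v}|=\sum_{r=u}^v(|x_r|-1)+1$ such that each $a_{u,u}$ is a cocycle representing $x_u$ and, for each $1\le u<v\le n$ with $v-u\le n-2$, $$d a_{u,v}=\sum_{r=u}^{v-1}\overline a_{u,r}\cdot a_{r+1,v}.$$ It determines the cocycle $c(D):=\sum_{r=1}^{n-1}\overline a_{1,r}\cdot a_{r+1,n}\in A^{|x_1|+\cdots+|x_n|-n+2}$. The $n$-fold Massey product is $$\langle x_1,\ldots,x_n\rangle:=\{[c(D)]\mid D \text{ a defining system for } \langle x_1,\ldots,x_n\rangle\}\subset H^{|x_1|+\cdots+|x_n|-n+2},$$ and it is $\emptyset$ if there is no defining system. An $A_\infty$-algebra $(A,d,\mu_2,\mu_3,\ldots)$ is a cochain complex $(A,d)$ with linear maps $\mu_n:A^{\otimes n}\to A$ of degree $2-n$, $n\ge2$, such that for all $n\ge 2$ $$\delta(\mu_n)=\sum (-1)^{i(l+1)+n}\,\mu_k\big(\mathrm{id}^{\otimes (i-1)}\otimes\mu_l\otimes \mathrm{id}^{\otimes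 (k-i)}\big),$$ the sum over $k,l\ge2$, $k+l=n+1$, $1\le i\le k$, where $\delta(f)=d\circ f-(-1)^{|f|}f\circ d$. A dg algebra is viewed as the $A_\infty$-algebra with $\mu_2=\cdot$ and $\mu_n=0$ for $n\ge3$. An $A_\infty$-morphism $\vartheta_\infty=(\vartheta,\vartheta_2,\vartheta_3,\ldots):(A,d,\mu_2,\ldots)\to(B,d,\nu_2,\ldots)$ consists of a cochain map $\vartheta=\vartheta_1:A\to B$ and linear maps $\vartheta_n:A^{\otimes n}\to B$ of degree $1-n$, $n\ge2$, such that for all $n\ge2$ $$\delta(\vartheta_n)+\sum_{k\ge2,\ r_1+\cdots+r_k=n,\ r_j\ge1}(-1)^{\sum_{i<j}r_i(r_j+1)}\nu_k(\vartheta_{r_1}\otimes\cdots\otimes\vartheta_{r_k})=\vartheta\circ\mu_n-\sum(-1)^{i(l+1)+n}\vartheta_k\big(\mathrm{id}^{\otimes(i-1)}\otimes\mu_l\otimes\mathrm{id}^{\otimes(k-i)}\big),$$ the last sum over $k,l\ge2$, $k+l=n+1$, $1\le i\le k$. A canonical minimal model of a dg algebra $A$ is an $A_\infty$-structure $(H,0,\mu_2,\mu_3,\ldots)$ on $H=H(A,d)$ for which there exists an $A_\infty$-morphism $\psi_\infty=(\psi,\psi_2,\ldots):(H,0,\mu_2,\mu_3,\ldots)\to(A,d,\cdot\,,0,0,\ldots)$, called a connecting $A_\infty$-morphism, with $[\psi(h)]=h$ for each $h\in H$. *)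

(* Defs.v *)
From HB Require Import structures.
From mathcomp Require Import all_boot all_order all_algebra.
From mathcomp Require Import boolp classical_sets.
From mathcomp Require Import zify.

Set Implicit Arguments.
Unset Strict Implicit.
Unset Printing Implicit Defensive.

Import GRing.Theory.
Local Open Scope ring_scope.

(* V is the internal direct sum of the subspaces V_ p, p in Z.  The total space
   replaces the family (V^p)_p, so that no transport along equalities of
   degrees is needed. *)
Definition is_grading (k : fieldType) (V : lmodType k) (V_ : int -> set V) :=
  [/\ forall p, V_ p 0 /\
        (forall (c : k) x y, V_ p x -> V_ p y -> V_ p (c *: x + y)),
      forall x, exists (s : seq int) (f : int -> V),
        (forall p, V_ p (f p)) /\ x = \sum_(p <- s) f p
    & forall (s : seq int) (f : int -> V),
        uniq s -> (forall p, V_ p (f p)) -> \sum_(p <- s) f p = 0 ->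
        {in s, forall p, f p = 0}].

Record cochainComplex (k : fieldType) := CochainComplex {
  cx_sort :> lmodType k;
  homog : int -> set cx_sort;
  diff : {linear cx_sort -> cx_sort};
  homog_grading : is_grading homog;
  diff_homog : forall p a, homog p a -> homog (p + 1) (diff a);
  diff_diff : forall a, diff (diff a) = 0
}.

Arguments homog {k} c p _.
Arguments diff {k c}.

Section Cohomology.
Variables (k : fieldType) (C : cochainComplex k).

Definition cocycle_pred : {pred C} := fun a => diff a == 0.

Lemma in_cocycle a : (a \in cocycle_pred) = (diff a == 0).
Proof. by []. Qed.

Lemma cocycle_submod : submod_closed cocycle_pred.
Proof.
split=> [|c a b]; first by rewrite in_cocycle linear0.
rewrite !in_cocycle => /eqP da /eqP db.
by rewrite linearP da db scaler0 addr0.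
Qed.

HB.instance Definition _ :=
  GRing.isSubmodClosed.Build k C cocycle_pred cocycle_submod.

Record cocycle := Cocycle { cocycle_val : C; _ : cocycle_val \in cocycle_pred }.

HB.instance Definition _ := [isSub for cocycle_val].
HB.instance Definition _ := [Choice of cocycle by <:].
HB.instance Definition _ := [SubChoice_isSubLmodule of cocycle by <:].

Definition coboundary_pred : {pred cocycle} :=
  fun z => `[< exists b, diff b = val z >].

Lemma in_coboundary z :
  reflect (exists b, diff b = val z) (z \in coboundary_pred).
Proof. exact: asboolP. Qed.

Lemma coboundary_submod : submod_closed coboundary_pred.
Proof.
split=> [|c y z]; first by apply/in_coboundary; exists 0; rewrite !linear0.
move=> /in_coboundary[y' dy] /in_coboundary[z' dz].
by apply/in_coboundary; exists (c *: y' + z'); rewrite !linearP dy dz.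
Qed.

HB.instance Definition _ :=
  GRing.isSubmodClosed.Build k cocycle coboundary_pred coboundary_submod.

(* ker d / im d *)
Definition coh := Quotient.quot coboundary_pred.

HB.instance Definition _ := GRing.Zmodule.on coh.

Definition coh_class (z : cocycle) : coh :=
  \pi_(Quotient.quot coboundary_pred)%qT z.

Lemma coh_classB : {morph coh_class : y z / y - z}.
Proof. exact: raddfB. Qed.

Lemma coh_classD : {morph coh_class : y z / y + z}.
Proof. exact: raddfD. Qed.

Lemma coh_class_eq y z :
  coh_class y = coh_class z <-> exists b, diff b = val y - val z.
Proof.
have E : (y - z \in coboundary_pred) = (coh_class y == coh_class z).
  exact: Quotient.idealrBE.
split=> [/eqP|[b db]].
  by rewrite -E => /in_coboundary[b db]; exists b; rewrite db raddfB.
by apply/eqP; rewrite -E; apply/in_coboundary; exists b; rewrite db raddfB.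
Qed.

Lemma coh_classP (h : coh) : exists z, coh_class z = h.
Proof. by exists (repr h); rewrite /coh_class reprK. Qed.

Definition coh_scale (c : k) (h : coh) : coh := coh_class (c *: repr h).

Lemma coh_scaleE c z : coh_scale c (coh_class z) = coh_class (c *: z).
Proof.
have /coh_class_eq[b db] : coh_class (repr (coh_class z)) = coh_class z.
  by rewrite /coh_class reprK.
apply/coh_class_eq; exists (c *: b).
by rewrite linearZZ db scalerBr.
Qed.

Fact coh_scaleA a b h : coh_scale a (coh_scale b h) = coh_scale (a * b) h.
Proof. by have [z <-] := coh_classP h; rewrite !coh_scaleE scalerA. Qed.

Fact coh_scale1 : left_id 1 coh_scale.
Proof. by move=> h; have [z <-] := coh_classP h; rewrite coh_scaleE scale1r. Qed.

Fact coh_scaleDr : right_distributive coh_scale +%R.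
Proof.
move=> a h h'; have [z <-] := coh_classP h; have [z' <-] := coh_classP h'.
by rewrite -coh_classD !coh_scaleE scalerDr coh_classD.
Qed.

Fact coh_scaleDl h : {morph coh_scale^~ h : a b / a + b}.
Proof.
by move=> a b; have [z <-] := coh_classP h; rewrite !coh_scaleE scalerDl coh_classD.
Qed.

HB.instance Definition _ :=
  GRing.Zmodule_isLmodule.Build k coh coh_scaleA coh_scale1 coh_scaleDr coh_scaleDl.

Lemma coh_class_is_linear : linear coh_class.
Proof. by move=> c y z; rewrite coh_classD -coh_scaleE. Qed.

HB.instance Definition _ :=
  GRing.isLinear.Build k cocycle coh _ coh_class coh_class_is_linear.

(* a is a cocycle and [a] = h *)
Definition represents (a : C) (h : coh) : Prop :=
  exists2 z : cocycle, val z = a & coh_class z = h.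

Definition coh_homog (p : int) : set coh :=
  [set h | exists2 a, homog C p a & represents a h].

Lemma cocycleP (z : cocycle) : diff (val z) = 0.
Proof. by case: z => a da; exact/eqP. Qed.

Lemma homog_sum_eq (s : seq int) (f g : int -> C) : uniq s ->
  (forall p, homog C p (f p)) -> (forall p, homog C p (g p)) ->
  \sum_(p <- s) f p = \sum_(p <- s) g p -> {in s, f =1 g}.
Proof.
have [sub _ ind] := homog_grading C.
move=> us hf hg /eqP; rewrite -subr_eq0 -sumrB => /eqP /ind E p ps.
apply/eqP; rewrite -subr_eq0; apply/eqP/E => // q.
by rewrite addrC -scaleN1r; apply: (sub q).2.
Qed.

(* a decomposition can be taken along any large enough duplicate-free list *)
Lemma homog_decomp (x : C) : exists2 s, uniq s &
  exists2 f, forall p, homog C p (f p) &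
    (forall p, p \notin s -> f p = 0) /\ x = \sum_(p <- s) f p.
Proof.
have [sub /(_ x)[s [f [hf ->]]] _] := homog_grading C.
have hZ c p a : homog C p a -> homog C p (c *: a).
  by move=> ha; rewrite -[_ *: _]addr0; apply: (sub p).2 => //; exact: (sub p).1.
exists (undup s); first exact: undup_uniq.
exists (fun p => (count_mem p s)%:R *: f p); first by move=> p; exact: hZ.
split=> [p|]; first by rewrite mem_undup => /count_memPn ->; rewrite scale0r.
rewrite -[LHS]big_undup_iterop_count; apply: eq_bigr => p _.
by rewrite Monoid.iteropE scaler_nat -Monoid.iteropE.
Qed.

Lemma sum_widen (V : zmodType) (s t : seq int) (f : int -> V) :
  uniq s -> uniq t -> {subset s <= t} -> (forall p, p \notin s -> f p = 0) ->
  \sum_(p <- t) f p = \sum_(p <- s) f p.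
Proof.
move=> us ut st f0; rewrite (bigID (mem s)) /= [X in _ + X]big1 // addr0.
rewrite -big_filter; apply: perm_big; apply: uniq_perm; rewrite ?filter_uniq //.
by move=> p; rewrite mem_filter; case: (boolP (p \in s)) => //= /st ->.
Qed.

Lemma diff_sum (s : seq int) (f : int -> C) : diff (\sum_(p <- s) f p) =
  \sum_(q <- [seq p + 1 | p <- s]) diff (f (q - 1)).
Proof. by rewrite linear_sum big_map; apply: eq_bigr => p _; rewrite addrK. Qed.

Lemma homog_diff_pred (f : int -> C) : (forall p, homog C p (f p)) ->
  forall q, homog C q (diff (f (q - 1))).
Proof. by move=> hf q; rewrite -[q in homog _ q](subrK 1); exact: diff_homog. Qed.

Lemma uniq_shift (s : seq int) : uniq s -> uniq [seq p + 1 | p <- s].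
Proof. by move=> us; rewrite map_inj_uniq //; exact: addIr. Qed.

Lemma coh_grading : is_grading coh_homog.
Proof.
have [sub dec ind] := homog_grading C.
split.
- move=> p; split.
    exists 0; first exact: (sub p).1.
    by exists 0; rewrite ?linear0.
  move=> c _ _ [a ha [y ya <-]] [b hb [z zb <-]]; subst a b.
  exists (val (c *: y + z)); first exact: (sub p).2.
  by exists (c *: y + z); rewrite // linearP.
- move=> h; have [z <-] := coh_classP h.
  have [s us [f hf [f0 zE]]] := homog_decomp (val z).
  have df p : diff (f p) = 0.
    have [ps|/f0->] := boolP (p \in s); last exact: linear0.
    have := ind _ _ (uniq_shift us) (homog_diff_pred hf).
    rewrite -diff_sum -zE cocycleP => /(_ erefl (p + 1)).
    by rewrite addrK; apply; exact: map_f.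
  have cf p : f p \in cocycle_pred by rewrite in_cocycle df.
  exists s, (fun p => coh_class (Cocycle (cf p))); split=> [p|].
    by exists (f p) => //; exists (Cocycle (cf p)).
  rewrite -linear_sum; congr coh_class; apply: val_inj.
  by rewrite zE linear_sum.
- move=> s h us hh h0.
  have {hh} /choice[z hz] p : exists z, homog C p (val z) /\ coh_class z = h p.
    by have [a ha [z za <-]] := hh p; exists z; rewrite za.
  have : coh_class (\sum_(p <- s) z p) = coh_class 0.
    by rewrite linear0 -h0 linear_sum; apply: eq_bigr => p _; exact: (hz p).2.
  move=> /coh_class_eq[b]; rewrite (linear0 val) subr0 (linear_sum val) => db.
  have [t ut [g hg [g0 bE]]] := homog_decomp b.
  pose F p := if p \in s then val (z p) else 0.
  pose G p := diff (g (p - 1)).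
  pose r := undup (s ++ [seq p + 1 | p <- t]).
  have FG : {in r, F =1 G}.
    apply: homog_sum_eq.
    + exact: undup_uniq.
    + by move=> p; rewrite /F; case: ifP => _; [exact: (hz p).1|exact: (sub p).1].
    + exact: homog_diff_pred.
    transitivity (diff b).
    + rewrite db (@sum_widen _ s) ?undup_uniq //.
      * by apply: eq_big_seq => p ps; rewrite /F ps.
      * by move=> p ps; rewrite mem_undup mem_cat ps.
      * by move=> p ps; rewrite /F (negPf ps).
    + rewrite bE diff_sum; symmetry; apply: sum_widen.
      * exact: uniq_shift.
      * exact: undup_uniq.
      * by move=> p pt; rewrite mem_undup mem_cat pt orbT.
      * move=> p pt; rewrite /G g0 ?linear0 //; apply: contra pt => pt.
        by rewrite -[p](subrK 1); exact: map_f.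
  move=> p ps; rewrite -(hz p).2 -(linear0 coh_class); apply/coh_class_eq.
  exists (g (p - 1)); rewrite (linear0 val) subr0.
  have := FG p; rewrite /F ps /G => -> //.
  by rewrite mem_undup mem_cat ps.
Qed.

Lemma coh_diff_homog p h : coh_homog p h -> coh_homog (p + 1) (\0 h : coh).
Proof. by move=> _; have [/(_ (p + 1))[]] := coh_grading. Qed.

Lemma coh_diff_diff (h : coh) : \0 (\0 h : coh) = 0 :> coh.
Proof. by []. Qed.

(* H = H(C, d), with zero differential *)
Definition cohomology : cochainComplex k :=
  CochainComplex coh_grading coh_diff_homog coh_diff_diff.

End Cohomology.

(* A linear map f_n : V^{(x) n} -> W is given by the n-linear map it induces,
   and a family (f_n)_{n >= m} by one function f on lists: f_n is f on lists of
   length n.  The values of f on lists shorter than m play no role. *)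
Section Operations.
Variable k : fieldType.

Definition multilinear_from (V W : lmodType k) (m : nat) (f : seq V -> W) :=
  forall (s t : seq V) (c : k) (x y : V), (m <= (size s + size t).+1)%N ->
    f (s ++ (c *: x + y) :: t) = c *: f (s ++ x :: t) + f (s ++ y :: t).

(* es lists degrees of the entries of s *)
Definition homog_seq (C : cochainComplex k) (es : seq int) (s : seq C) :=
  size es = size s /\
  forall i, (i < size s)%N -> homog C (nth 0 es i) (nth 0 s i).

(* f_n has degree c - n for all n >= m *)
Definition has_degree_from (C D : cochainComplex k) (m : nat) (c : int)
    (f : seq C -> D) :=
  forall es s, homog_seq es s -> (m <= size s)%N ->
    homog D (\sum_(e <- es) e + c - (size s)%:Z) (f s).

(* (f o (id^{(x) (i-1)} (x) g (x) id^{(x) (n-l-i+1)})) (s_1, ..., s_n), for g of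
   degree p with l inputs, on entries of degrees es *)
Definition insert_app (V W : lmodType k) (i l : nat) (p : int)
    (f : seq V -> W) (g : seq V -> V) (es : seq int) (s : seq V) : W :=
  (-1) ^ (p * \sum_(e <- take i.-1 es) e) *:
    f (take i.-1 s ++ g (take l (drop i.-1 s)) :: drop (i.-1 + l) s).

(* delta(f) = d o f - (-1)^p f o d, for f of degree p *)
Definition hom_diff (C D : cochainComplex k) (p : int) (f : seq C -> D)
    (es : seq int) (s : seq C) : D :=
  diff (f s) - (-1) ^ p *: \sum_(1 <= i < (size s).+1)
    insert_app i 1 1 f (fun t => diff (head 0 t)) es s.

(* The sum over k, l >= 2, k + l = n + 1, 1 <= i <= k of
   (-1)^(i(l+1)+n) f_k o (id^{(x) (i-1)} (x) mu_l (x) id^{(x) (k-i)}) *)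
Definition insert_sum (V W : lmodType k) (f : seq V -> W) (mu : seq V -> V)
    (es : seq int) (s : seq V) : W :=
  let n := size s in
  \sum_(2 <= m < n) \sum_(2 <= l < n | (m + l)%N == n.+1)
    \sum_(1 <= i < m.+1)
      (-1) ^+ (i * l.+1 + n) *: insert_app i l (2 - l%:Z) f mu es s.

Definition ainf_structure (C : cochainComplex k) (mu : seq C -> C) :=
  [/\ multilinear_from 2 mu,
      has_degree_from 2 2 mu
    & forall es s, homog_seq es s -> (2 <= size s)%N ->
        hom_diff (2 - (size s)%:Z) mu es s = insert_sum mu mu es s].

(* (nu_k o (theta_{r_1} (x) ... (x) theta_{r_k})) (s), the sign coming from moving
   theta_{r_j}, of degree 1 - r_j, past the i-th block of s for i < j *)
Definition tensor_app (V W : lmodType k) (nu : seq W -> W) (theta : seq V -> W)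
    (r : seq nat) (es : seq int) (s : seq V) : W :=
  (-1) ^ (\sum_(0 <= j < size r) \sum_(0 <= i < j)
            (1 - (nth 0%N r j)%:Z) * \sum_(e <- nth [::] (reshape r es) i) e) *:
    nu [seq theta b | b <- reshape r s].

(* The sum over k >= 2 and r_1 + ... + r_k = n, r_j >= 1, of
   (-1)^(sum_{i<j} r_i (r_j + 1)) nu_k o (theta_{r_1} (x) ... (x) theta_{r_k}) *)
Definition tensor_sum (V W : lmodType k) (nu : seq W -> W) (theta : seq V -> W)
    (es : seq int) (s : seq V) : W :=
  let n := size s in
  \sum_(2 <= m < n.+1) \sum_(t : m.-tuple 'I_n.+1 |
        let r := map val t in all (leq 1) r && (sumn r == n))
    let r := map val t in
    (-1) ^+ (\sum_(0 <= j < m) \sum_(0 <= i < j)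
               nth 0%N r i * (nth 0%N r j).+1)%N *:
      tensor_app nu theta r es s.

(* theta [:: a] is the value at a of the cochain map theta_1 *)
Definition ainf_morphism (C D : cochainComplex k) (mu : seq C -> C)
    (nu : seq D -> D) (theta : seq C -> D) :=
  [/\ multilinear_from 1 theta,
      has_degree_from 1 1 theta,
      forall a, diff (theta [:: a]) = theta [:: diff a]
    & forall es s, homog_seq es s -> (2 <= size s)%N ->
        hom_diff (1 - (size s)%:Z) theta es s + tensor_sum nu theta es s
        = theta [:: mu s] - insert_sum theta mu es s].

End Operations.

(* No unit is required. *)
Record dgAlgebra (k : fieldType) := DGAlgebra {
  dga_cx :> cochainComplex k;
  dmul : dga_cx -> dga_cx -> dga_cx;
  dmul_linearl : forall b, linear (fun a => dmul a b);
  dmul_linearr : forall a, linear (dmul a);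
  dmulA : associative dmul;
  dmul_homog : forall p q a b,
    homog dga_cx p a -> homog dga_cx q b -> homog dga_cx (p + q) (dmul a b);
  diff_dmul : forall p a b, homog dga_cx p a ->
    diff (dmul a b) = dmul (diff a) b + (-1) ^ p *: dmul a (diff b)
}.

Arguments dmul {k d}.

Section DGAlgebra.
Variables (k : fieldType) (A : dgAlgebra k).

(* A as an A-infinity algebra: mu_2 is the product and mu_n = 0 for n >= 3 *)
Definition dga_op (s : seq A) : A := if s is [:: a; b] then dmul a b else 0.

Lemma dmul0l b : dmul 0 b = 0 :> A.
Proof.
have := dmul_linearl b 1 0 0; rewrite scaler0 addr0 scale1r => /eqP.
by rewrite -subr_eq0 opprD addrA subrr sub0r oppr_eq0 => /eqP.
Qed.

Lemma dmul0r a : dmul a 0 = 0 :> A.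
Proof.
have := dmul_linearr a 1 0 0; rewrite scaler0 addr0 scale1r => /eqP.
by rewrite -subr_eq0 opprD addrA subrr sub0r oppr_eq0 => /eqP.
Qed.

Lemma dga_op_size s : size s != 2%N -> dga_op s = 0.
Proof. by case: s => [|a [|b [|c s]]]. Qed.

Lemma dga_op0 s t : dga_op (s ++ 0 :: t) = 0.
Proof.
by case: s t => [|a [|b s]] [|c [|e t]] //=; rewrite ?dmul0l ?dmul0r //; case: s.
Qed.

Lemma dga_ainf : ainf_structure dga_op.
Proof.
split.
- case=> [|a [|a' s]] [|b [|b' t]] //= c x y _; rewrite ?scaler0 ?addr0 //.
  + exact: dmul_linearl.
  + exact: dmul_linearr.
  + by case: s => [|? ?] /=; rewrite scaler0 addr0.
  + by case: s => [|? ?] /=; rewrite scaler0 addr0.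
  + by case: s => [|? ?] /=; rewrite scaler0 addr0.
- move=> es s [sz hs] _; have [s2|s2] := eqVneq (size s) 2%N; last first.
    by rewrite dga_op_size //; have [h0 _ _] := homog_grading A; exact: (h0 _).1.
  case: s s2 sz hs => [|a [|b [|? ?]]] //= _; case: es => [|p [|q []]] //= _ hs.
  rewrite !big_cons big_nil addr0 addrK.
  by apply: dmul_homog; [exact: (hs 0%N)|exact: (hs 1%N)].
move=> es s hes s2; rewrite /hom_diff /insert_sum.
have [sz|s3] := leqP (size s) 2%N.
  have {s2}sz : size s = 2%N by apply/eqP; rewrite eqn_leq sz.
  rewrite sz [RHS]big_geq //.
  case: s sz hes => [|a [|b [|? ?]]] //= _ [].
  case: es => [|p [|q []]] //= _ hs.
  rewrite big_ltn // big_ltn // big_geq // addr0 /insert_app /= big_nil !mulr0 !expr0z.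
  rewrite big_cons big_nil addr0 mul1r !scale1r (diff_dmul _ (hs 0%N isT)) /=.
  by rewrite subrr.
rewrite dga_op_size ?gtn_eqF // linear0 sub0r big_nat big1 => [|i /andP[i0 ilt]].
  rewrite scaler0 oppr0; move: s3; rewrite leq_eqVlt => /orP[/eqP sz|s4].
    rewrite -sz big_nat1 big_mkcond big_nat1 /= big_ltn // big_ltn // big_geq // addr0.
    case: s sz s2 hes => [|a [|b [|c [|? ?]]]] //= _ _ [].
    case: es => [|p [|q [|r []]]] //= _ hs.
    rewrite /insert_app subrr !mul0r expr0z !scale1r /= dmulA.
    by rewrite -signr_odd /= expr0 scale1r -signr_odd /= expr1 scaleN1r subrr.
  symmetry; rewrite big_nat big1 // => m /andP[m2 mn].
  rewrite big_nat_cond big1 // => l /andP[/andP[l2 ln] /eqP ml].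
  rewrite big_nat big1 // => i /andP[i1 im]; rewrite /insert_app.
  have [l3|l3] := eqVneq l 2%N; last first.
    rewrite (@dga_op_size (take _ _)) ?dga_op0 ?scaler0 //.
    by rewrite size_takel ?size_drop //; lia.
  rewrite (@dga_op_size (_ ++ _)) ?scaler0 // size_cat /= size_takel ?size_drop.
    by apply/eqP; lia.
  by lia.
rewrite /insert_app (@dga_op_size (_ ++ _)) ?scaler0 // size_cat /=.
by rewrite size_takel ?size_drop; [apply/eqP; lia|lia].
Qed.

(* psi_infty : (H, 0, mu_2, ...) -> (A, d, ., 0, ...) with [psi(h)] = h *)
Definition connecting_morphism (mu : seq (cohomology A) -> cohomology A)
    (psi : seq (cohomology A) -> A) :=
  ainf_morphism mu dga_op psi /\
  forall h : cohomology A, represents (psi [:: h]) h.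

Definition canonical_minimal_model (mu : seq (cohomology A) -> cohomology A) :=
  ainf_structure mu /\ exists psi, connecting_morphism mu psi.

(* x u, ..., x v *)
Definition subinterval (T : Type) (x : nat -> T) (u v : nat) : seq T :=
  [seq x i | i <- index_iota u v.+1].

Section Massey.
(* The classes x_1, ..., x_n are x 1, ..., x n, of degrees dx 1, ..., dx n; the
   degrees are explicit because that of a zero class is not determined.  Values
   of x, dx and a at other indices play no role. *)
Variables (n : nat) (x : nat -> cohomology A) (dx : nat -> int).

(* |a_{u,v}| *)
Definition ds_degree (u v : nat) : int := \sum_(u <= r < v.+1) (dx r - 1) + 1.

(* sum_{r=u}^{v-1} \overline{a_{u,r}} a_{r+1,v} *)
Definition massey_sum (a : nat -> nat -> A) (u v : nat) : A :=
  \sum_(u <= r < v) dmul ((-1) ^ ds_degree u r *: a u r) (a r.+1 v).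

Definition defining_system (a : nat -> nat -> A) :=
  [/\ forall u v, (1 <= u <= v)%N -> (v <= n)%N ->
        homog A (ds_degree u v) (a u v),
      forall u, (1 <= u <= n)%N -> represents (a u u) (x u)
    & forall u v, (1 <= u < v)%N -> (v <= n)%N -> (v - u <= n - 2)%N ->
        diff (a u v) = massey_sum a u v].

Definition massey_product : set (cohomology A) :=
  [set h | exists2 a, defining_system a & represents (massey_sum a 1 n) h].

End Massey.
End DGAlgebra.

(* Main.v *)
(* Evaluated on a subinterval x_u, ..., x_v, the equation of the morphism psi
   loses every term containing an operation on a proper subinterval.  Since the
   target has no operation beyond the product, it becomes
     d psi(x_u..x_v) = psi(mu(x_u..x_v))
                       - sum_r (+/-) psi(x_u..x_r) psi(x_{r+1}..x_v).
   After rescaling by the signs of the a_{u,v} this is the equation of a defining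
   system when mu(x_u..x_v) = 0, while for (u,v) = (1,n) it says that c(D) and
   eps psi(mu(x_1..x_n)) differ by the coboundary of a_{1,n}. *)

Require Import Defs.
From mathcomp Require Import all_boot all_order all_algebra.
From mathcomp Require Import boolp classical_sets.
From mathcomp Require Import zify.

Set Implicit Arguments.
Unset Strict Implicit.
Unset Printing Implicit Defensive.

Import GRing.Theory.
Local Open Scope ring_scope.

(** Sign comparisons below add an explicit even integer to one exponent, which leaves an identity
    between integers. *)
Lemma signz_mod2 (R : unitRingType) (z c : int) :
  (-1) ^ (z + c * 2) = (-1) ^ z :> R.
Proof.
rewrite exprzDr ?unitrN1 // mulrC -exprz_exp -[(-1) ^ 2]/((-1) ^+ 2).
by rewrite sqrrN expr1n exp1rz mulr1.
Qed.

(** * Subintervals *)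

Lemma size_subinterval (T : Type) (x : nat -> T) u v :
  size (subinterval x u v) = (v.+1 - u)%N.
Proof. by rewrite size_map size_iota. Qed.

Lemma nth_subinterval (T : Type) (x0 : T) (x : nat -> T) u v i :
  (i < v.+1 - u)%N -> nth x0 (subinterval x u v) i = x (u + i)%N.
Proof. by move=> iv; rewrite (nth_map 0%N) ?size_iota // nth_iota. Qed.

Lemma take_subinterval (T : Type) (x : nat -> T) u v p :
  (0 < p <= v.+1 - u)%N ->
  take p (subinterval x u v) = subinterval x u (u + p).-1.
Proof.
move=> /andP[p0 pv]; rewrite -map_take take_iota /subinterval /index_iota.
by congr (map _ (iota _ _)); lia.
Qed.

Lemma drop_subinterval (T : Type) (x : nat -> T) u v p :
  drop p (subinterval x u v) = subinterval x (u + p) v.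
Proof.
rewrite -map_drop drop_iota /subinterval /index_iota.
by congr (map _ (iota _ _)); lia.
Qed.

Lemma subinterval1 (T : Type) (x : nat -> T) u : subinterval x u u = [:: x u].
Proof. by rewrite /subinterval /index_iota subSnn. Qed.

Lemma big_subinterval (V : zmodType) (f : nat -> V) u v :
  \sum_(e <- subinterval f u v) e = \sum_(u <= i < v.+1) f i.
Proof. by rewrite big_map. Qed.

(** * Reducing the terms of the morphism equation *)

Section Multilinear.
Variables (k : fieldType) (V W : lmodType k).

Lemma multilinear_from0 m (f : seq V -> W) s t : multilinear_from m f ->
  (m <= (size s + size t).+1)%N -> f (s ++ 0 :: t) = 0.
Proof.
move=> fl mst; have := fl s t 1 0 0 mst.
rewrite scaler0 addr0 scale1r => /eqP.
by rewrite -[X in X == _]addr0 (inj_eq (addrI _)) eq_sym => /eqP.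
Qed.

(** The arities in [insert_sum] are at least 2 and add up to [size s + 1], so [mu] only meets proper
    blocks of [s], here at offset [i] counted from 0; [f] then gets a zero entry. *)
Lemma insert_sum0 (f : seq V -> W) (mu : seq V -> V) es s :
  multilinear_from 1 f ->
  (forall i l, (2 <= l < size s)%N -> (i + l <= size s)%N ->
     mu (take l (drop i s)) = 0) ->
  insert_sum f mu es s = 0.
Proof.
move=> fl mu0; rewrite /insert_sum big_nat big1 // => m /andP[m2 mn].
rewrite big_nat_cond big1 // => l /andP[/andP[l2 ln] /eqP ml].
rewrite big_nat big1 // => i /andP[i1 im]; rewrite /insert_app.
rewrite mu0 ?l2 //; last by lia.
by rewrite (multilinear_from0 fl) ?scaler0.
Qed.

End Multilinear.

Section CochainComplex.
Variables (k : fieldType) (C : cochainComplex k).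

Lemma homogZ p (c : k) (a : C) : homog C p a -> homog C p (c *: a).
Proof.
have [/(_ p)[h0 hl] _ _] := homog_grading C.
by move=> ha; rewrite -[_ *: _]addr0; exact: hl.
Qed.

Lemma representsZ (c : k) (a : C) (h : coh C) :
  represents a h -> represents (c *: a) (c *: h).
Proof. by case=> z <- <-; exists (c *: z); rewrite linearZ. Qed.

Lemma representsD_diff (a b : C) (h : coh C) :
  represents a h -> represents (diff b + a) h.
Proof.
case=> z <- <-.
have zb : diff b + val z \in @cocycle_pred k C.
  by rewrite in_cocycle linearD /= diff_diff cocycleP addr0.
by exists (Cocycle zb) => //; apply/coh_class_eq; exists b; rewrite /= addrK.
Qed.

(** The source has zero differential, so each term of [f o d] has a zero entry. *)
Lemma hom_diff_cohomology (D : cochainComplex k) p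
    (f : seq (cohomology C) -> D) es s :
  multilinear_from 1 f -> hom_diff p f es s = diff (f s).
Proof.
move=> fl; rewrite /hom_diff big_nat big1 ?scaler0 ?subr0 // => i _.
by rewrite /insert_app (multilinear_from0 fl) ?scaler0.
Qed.

End CochainComplex.

(** The product takes two inputs, so only compositions of [size s] into two parts contribute. *)
Lemma tensor_sum_dga (k : fieldType) (V : lmodType k) (A : dgAlgebra k)
    (theta : seq V -> A) es s : (2 <= size s)%N ->
  tensor_sum (@dga_op k A) theta es s =
  \sum_(1 <= p < size s)
    (-1) ^ ((p * (size s - p).+1)%N%:Z
            + (1 - (size s - p)%N%:Z) * \sum_(e <- take p es) e)
      *: dmul (theta (take p s)) (theta (drop p s)).
Proof.
move=> s2; rewrite /tensor_sum big_ltn ?ltnS //.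
rewrite [X in _ + X]big_nat [X in _ + X]big1.
  rewrite addr0.
  (* The first part determines the second: here [rev_ord i] has value [size s - i]. *)
  rewrite (reindex_onto (fun i : 'I_(size s).+1 => [tuple i; rev_ord i])
             (fun t => thead t)) /=; last first.
    move=> t; case/tupleP: t => i t; case/tupleP: t => j t; rewrite tuple0 /=.
    rewrite addn0 => /andP[_ /eqP ij]; apply/val_inj => /=; rewrite theadE.
    by congr [:: _; _]; apply/val_inj => /=; lia.
  rewrite [RHS](@big_nat_widen _ _ _ _ _ (size s).+1) // [RHS]big_geq_mkord.
  rewrite big_mkcond [RHS]big_mkcond /=; apply: eq_bigr => i _.
  rewrite theadE eqxx andbT addn0 subSS subnKC -1?ltnS // eqxx !andbT subn_gt0.
  rewrite andbC; case: ifP => // /andP[ilt i0].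
  rewrite /tensor_app /= (@take_oversize _ _ (drop i s)) ?size_drop //.
  have sum2 (V' : nmodType) (F : nat -> nat -> V') :
      \sum_(0 <= j < 2) \sum_(0 <= i < j) F i j = F 0%N 1%N.
    by rewrite big_ltn // !big_nat1 big_geq // add0r.
  by rewrite !sum2 scalerA exprzDr ?unitrN1.
move=> m /andP[m2 _]; rewrite big1 // => t _.
rewrite /tensor_app dga_op_size ?scaler0 //.
by rewrite size_map size_reshape size_map size_tuple; apply/eqP; lia.
Qed.

(** * Comparison of signs *)

(* The exponent of the sign of a_{u,v}, with the sum reindexed by j = u + i. *)
Definition massey_sign (dx : nat -> int) (u v : nat) : int :=
  ((v - u) * (v - u).+1 %/ 2)%N%:Z + \sum_(u <= j < v.+1) (v + j)%N%:Z * dx j.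

(** The exponent is [2 * u * dx u], so one sign formula also covers the diagonal elements
    [psi(x_u)]. *)
Lemma massey_sign_refl (R : unitRingType) dx u :
  (-1) ^ massey_sign dx u u = 1 :> R.
Proof.
rewrite /massey_sign subnn mul0n div0n big_nat1.
by rewrite -[RHS](signz_mod2 _ 0 (u%:Z * dx u)); congr (_ ^ _); lia.
Qed.

Lemma massey_signE (R : unitRingType) dx u v : (u <= v)%N ->
  (-1) ^ (((v - u) * (v - u).+1 %/ 2)%N%:Z
          + \sum_(0 <= i < (v - u).+1) (u + v + i)%N%:Z * dx (u + i)%N)
  = (-1) ^ massey_sign dx u v :> R.
Proof.
move=> uv; rewrite /massey_sign; congr (_ ^ (_ + _)).
rewrite -[X in \sum_(X <= j < v.+1) _]add0n big_addn subSn //.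
by apply: eq_bigr => i _; rewrite [(i + u)%N]addnC addnCA addnA.
Qed.

Lemma half_triangle n : ((n * n.+1 %/ 2) * 2 = n * n.+1)%N.
Proof. by apply: divnK; rewrite dvdn2 oddM /= andbN. Qed.

(** On the left are the signs in a term of [massey_sum], on the right those of [a_{u,v}] and of the
    same term in the morphism equation. The ratio -1 is independent of [r], so a single rescaling
    turns one sum into the other. *)
Lemma massey_sign_cat (R : unitRingType) dx u r v : (u <= r < v)%N ->
  (-1) ^ ds_degree dx u r * (-1) ^ massey_sign dx u r
    * (-1) ^ massey_sign dx r.+1 v
  = - ((-1) ^ massey_sign dx u v
       * (-1) ^ (((r.+1 - u) * (v - r).+1)%N%:Z
                 + (1 - (v - r)%N%:Z) * \sum_(u <= j < r.+1) dx j)) :> R.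
Proof.
move=> /andP[ur rv]; rewrite -[RHS]mulN1r -[X in _ = X * _]expr1z.
rewrite -!exprzDr ?unitrN1 // /ds_degree /massey_sign sumrB sumr_const_nat.
rewrite [in RHS](big_cat_nat (n := r.+1)) /=; [|by lia..].
set D := \sum_(u <= j < r.+1) dx j.
set E := \sum_(r.+1 <= j < v.+1) _.
(* Passing from the weights [r + j] of [a_{u,r}] to the weights [v + j] of [a_{u,v}] costs [v - r]
   times the degree sum [D]. *)
have -> : \sum_(u <= j < r.+1) (r + j)%N%:Z * dx j
   = \sum_(u <= j < r.+1) (v + j)%N%:Z * dx j - (v - r)%N%:Z * D.
  rewrite mulr_sumr -sumrB; apply: eq_bigr => j _.
  by rewrite -mulrBl; congr (_ * _); lia.
set F := \sum_(u <= j < r.+1) _ * _.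
rewrite (_ : (v - u)%N = (r - u + (v - r.+1)).+1); last by lia.
rewrite (_ : (v - r)%N = (v - r.+1).+1); last by lia.
rewrite (_ : (r.+1 - u)%N = (r - u).+1); last by lia.
move: (r - u)%N (v - r.+1)%N => p q.
(* With [T(m) = m(m+1)/2] one has [T(p+q+1) = T(p) + T(q) + (p+1)(q+1)], so the exponents differ by
   twice [pq + 2p + q + 2]. *)
rewrite -[RHS](signz_mod2 _ _ (- (p * q + 2 * p + q + 2)%N%:Z)).
congr (_ ^ _).
have := half_triangle p; have := half_triangle q.
have := half_triangle (p + q).+1.
move: (_ %/ 2)%N (_ %/ 2)%N (_ %/ 2)%N => tpq tq tp.
by rewrite natz; move: D E F => D E F; lia.
Qed.

(** * The morphism equation on a subinterval *)

Section Connecting.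
Variables (k : fieldType) (A : dgAlgebra k).
Variables (mu : seq (cohomology A) -> cohomology A).
Variables (psi : seq (cohomology A) -> A).
Hypothesis hpsi : connecting_morphism mu psi.
Variables (x : nat -> cohomology A) (dx : nat -> int).

Lemma homog_subinterval u v :
  (forall i, (u <= i <= v)%N -> homog (cohomology A) (dx i) (x i)) ->
  homog_seq (subinterval dx u v) (subinterval x u v).
Proof.
move=> hx; split=> [|i]; rewrite !size_subinterval // => iv.
by rewrite !nth_subinterval //; apply: hx; lia.
Qed.

Lemma diff_connecting u v : (u < v)%N ->
  (forall i, (u <= i <= v)%N -> homog (cohomology A) (dx i) (x i)) ->
  (forall i j, (u <= i < j)%N -> (j <= v)%N -> (j - i < v - u)%N ->
     mu (subinterval x i j) = 0) ->
  diff (psi (subinterval x u v)) =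
    psi [:: mu (subinterval x u v)]
    - \sum_(u <= r < v)
        (-1) ^ (((r.+1 - u) * (v - r).+1)%N%:Z
                + (1 - (v - r)%N%:Z) * \sum_(u <= j < r.+1) dx j)
          *: dmul (psi (subinterval x u r)) (psi (subinterval x r.+1 v)).
Proof.
move=> uv hx mu0; have [[psil _ _ psiE] _] := hpsi.
have s2 : (2 <= size (subinterval x u v))%N by rewrite size_subinterval; lia.
have := psiE _ _ (homog_subinterval hx) s2.
rewrite hom_diff_cohomology // insert_sum0 //; last first.
  move=> i l; rewrite size_subinterval drop_subinterval => l2 il.
  by rewrite take_subinterval ?mu0 //; lia.
rewrite subr0 tensor_sum_dga // => /(canRL (addrK _)) ->; congr (_ - _).
(* The length [p] of the first block is replaced by its last index [r = u + p - 1]. *)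
rewrite size_subinterval subSn 1?ltnW // big_add1 /=.
rewrite -[X in _ = \sum_(X <= _ < _) _]add0n big_addn.
apply: eq_big_nat => i /andP[_ iv].
rewrite drop_subinterval !take_subinterval ?big_subinterval; [|by lia..].
have -> : ((i + u).+1 - u = i.+1)%N by lia.
have -> : (v - (i + u) = (v - u).+1 - i.+1)%N by lia.
by rewrite addnS addnC.
Qed.

(** The rescaled morphism equation, solved for the products. The [mu] term is kept, so that the case
    [(1,n)] is included. *)
Lemma massey_sum_connecting u v : (u < v)%N ->
  (forall i, (u <= i <= v)%N -> homog (cohomology A) (dx i) (x i)) ->
  (forall i j, (u <= i < j)%N -> (j <= v)%N -> (j - i < v - u)%N ->
     mu (subinterval x i j) = 0) ->
  massey_sum dx
    (fun u v => (-1) ^ massey_sign dx u v *: psi (subinterval x u v)) u v =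
  (-1) ^ massey_sign dx u v *:
    (diff (psi (subinterval x u v)) - psi [:: mu (subinterval x u v)]).
Proof.
move=> uv hx mu0; rewrite diff_connecting // addrAC subrr sub0r scalerN.
rewrite scaler_sumr -sumrN; apply: eq_big_nat => r urv.
have dmulZl (c : k) (a b : A) : dmul (c *: a) b = c *: dmul a b.
  by have := dmul_linearl b c a 0; rewrite !addr0 dmul0l addr0.
have dmulZr (c : k) (a b : A) : dmul a (c *: b) = c *: dmul a b.
  by have := dmul_linearr a c b 0; rewrite !addr0 dmul0r addr0.
by rewrite !dmulZl dmulZr !scalerA massey_sign_cat // scaleNr.
Qed.

End Connecting.

Theorem lemma14 (k : fieldType) (A : dgAlgebra k) (n : nat) (hn : (2 <= n)%N)
    (x : nat -> cohomology A) (dx : nat -> int)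
    (hx : forall i, (1 <= i <= n)%N -> homog (cohomology A) (dx i) (x i))
    (mu : seq (cohomology A) -> cohomology A)
    (psi : seq (cohomology A) -> A)
    (hmu : canonical_minimal_model mu)
    (hpsi : connecting_morphism mu psi)
    (hvanish : forall m u v : nat, (2 <= m <= n - 1)%N ->
       (1 <= u <= v)%N -> (v <= n)%N -> (v - u).+1 = m ->
       mu (subinterval x u v) = 0) :
  let a (u v : nat) : A :=
    if u == v then psi [:: x u]
    else (-1) ^ (((v - u) * (v - u).+1 %/ 2)%N%:Z
                 + \sum_(0 <= i < (v - u).+1) (u + v + i)%N%:Z * dx (u + i)%N)
         *: psi (subinterval x u v) in
  let eps : k :=
    (-1) ^ (((n + 2) * (n + 1) %/ 2)%N%:Z
            + \sum_(1 <= i < n.+1) (n + i)%N%:Z * dx i) in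
  defining_system n x dx a /\
  massey_product n x dx (eps *: mu (subinterval x 1 n)).
Proof.
move=> a eps; have [[psil psi_deg _ _] psi_rep] := hpsi.
have aE u v : (u <= v)%N ->
    a u v = (-1) ^ massey_sign dx u v *: psi (subinterval x u v).
  rewrite /a; case: eqVneq => [<- _|_ uv]; last by rewrite massey_signE.
  by rewrite massey_sign_refl scale1r subinterval1.
have massey_aE u v : (1 <= u < v)%N -> (v <= n)%N ->
    massey_sum dx a u v = (-1) ^ massey_sign dx u v *:
      (diff (psi (subinterval x u v)) - psi [:: mu (subinterval x u v)]).
  move=> /andP[u1 uv] vn; rewrite -(massey_sum_connecting hpsi) //.
  - by apply: eq_big_nat => r /andP[ur rv]; rewrite !aE.
  - by move=> i /andP[ui iv]; apply: hx; lia.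
  - by move=> i j uij jv ijuv; apply: (hvanish (j - i).+1); lia.
(* [(n+2)(n+1)/2] exceeds [(n-1)n/2] by [2n + 1], whence the minus sign and the even correction
   [2n]. *)
have epsE : eps = - (-1) ^ massey_sign dx 1 n.
  rewrite -[RHS]mulN1r -[X in _ = X * _]expr1z -exprzDr ?unitrN1 //.
  rewrite -[RHS](signz_mod2 _ _ n%:Z) /eps /massey_sign; congr (_ ^ _).
  have := half_triangle (n - 1); have := half_triangle n.+1.
  rewrite addn2 addn1 mulnC; move: (_ %/ 2)%N (_ %/ 2)%N => s t.
  by move: (\sum_(_ <= _ < _) _) => D; nia.
have a_ds : defining_system n x dx a.
  split=> [u v uv vn|u _|u v uv vn uvn].
  - rewrite aE; last by lia.
    apply: homogZ.
    have hs : homog_seq (subinterval dx u v) (subinterval x u v).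
      by apply: homog_subinterval => i uiv; apply: hx; lia.
    (* On [v - u + 1] entries [psi] has degree [u - v]: one less per entry, plus the final 1 of
       [ds_degree]. *)
    have := psi_deg _ _ hs; rewrite size_subinterval big_subinterval.
    rewrite /ds_degree sumrB sumr_const_nat natz [_ + 1 - _]addrAC.
    by apply; lia.
  - by rewrite /a eqxx.
  - rewrite massey_aE // aE; last by lia.
    (* The bound [v - u <= n - 2] is exactly length at most [n - 1]. *)
    rewrite (hvanish (v - u).+1); [|by lia..].
    have -> : psi [:: 0] = 0.
      exact: (multilinear_from0 (s := [::]) (t := [::]) psil).
    by rewrite subr0 linearZ.
split=> //; exists a => //; rewrite massey_aE ?leqnn ?hn //.
(* Moving the sign inside splits [c(D)] into a coboundary and [eps] times a representative of
   [mu(x_1,...,x_n)]. *)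
rewrite scalerBr -linearZ -scaleNr -epsE.
by apply: representsD_diff; exact: representsZ.
Qed.
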